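(* Let $\mathbb{F}_2$ be the free group on two generators, with word length $\ell$, and let $\alpha(n):=\min\{\ell(w) : w\in\gamma_n(\mathbb{F}_2)\setminus\{e\}\}$ for $n\ge 1$ and $\beta(n):=\min\{\ell(w) : w\in\mathbb{F}_2^{(n)}\setminus\{e\}\}$ for $n\ge 0$. Let $$\alpha:=\lim_{n\to\infty}\frac{\log_2(\alpha(n))}{\log_2(n)},\qquad \beta:=\lim_{n\to\infty}\frac{\log_2(\beta(n))}{n}.$$ Then: (1) $$\alpha\le\frac{\log_2(3+\sqrt{17})-1}{\log_2(1+\sqrt2)}=1.4411\ldots,$$ or equivalently $\alpha(n)\preceq n^{\frac{\log_2(3+\sqrt{17})-1}{\log_2(1+\sqrt2)}+\varepsilon}$ for all $\varepsilon>0$. (2) $$\log_2(3)\le\beta\le\log_2(3+\sqrt{17})-1=1.8325\ldots,$$ or equivalently $\log_2(3)\cdot n\le\log_2(\beta(n))\le(\log_2(3+\sqrt{17})-1)\cdot n+o(n)$, where the left inequality holds for all $n$.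
   Context: $\mathbb{F}_2$ is the free group on generators $a,b$; $\ell(w)$ is the word length with respect to $\{a,a^{-1},b,b^{-1}\}$. The commutator is $[x,y]=xyx^{-1}y^{-1}$, and for subgroups $\Lambda_1,\Lambda_2$, $[\Lambda_1,\Lambda_2]$ is the subgroup generated by all $[\lambda_1,\lambda_2]$ with $\lambda_i\in\Lambda_i$. Lower central series: $\gamma_1(\Gamma)=\Gamma$, $\gamma_{n+1}(\Gamma)=[\gamma_n(\Gamma),\Gamma]$. Derived series: $\Gamma^{(0)}=\Gamma$, $\Gamma^{(n+1)}=[\Gamma^{(n)},\Gamma^{(n)}]$. The two limits defining the numbers $\alpha$ and $\beta$ exist. For functions $f,g$ on the positive integers, $f(n)\preceq g(n)$ means that there is a constant $C$ with $f(n)\le C\,g(Cn)$ for all $n$. $o(n)$ denotes a function $h$ with $h(n)/n\to0$. *)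

(* Defs.v *)
From HB Require Import structures.
From mathcomp Require Import all_boot all_order all_algebra all_fingroup.
From mathcomp Require Import all_classical all_reals all_analysis.

Set Implicit Arguments.
Unset Strict Implicit.
Unset Printing Implicit Defensive.

Import Order.TTheory GRing.Theory Num.Theory.
Import numFieldNormedType.Exports.

Local Open Scope classical_set_scope.

Definition min_nat (A : set nat) : nat := xget 0%N (A `&` lbound A).

Lemma min_natP (A : set nat) : A !=set0 -> A (min_nat A) /\ lbound A (min_nat A).
Proof.
move=> [k Ak].
suff : (A `&` lbound A) !=set0 by move=> [m Am]; exact: (xgetI 0%N Am).
have exA : exists m, `[< A m >] by exists k; apply/asboolP.
exists (ex_minn exA); case: ex_minnP => m /asboolP Am minm; split => //.
by move=> j Aj; apply: minm; apply/asboolP.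
Qed.

Section GroupNotions.
Local Open Scope group_scope.
Variable G : groupType.

(* x y x^-1 y^-1, whereas the library's [~ x, y] is x^-1 y^-1 x y *)
Definition comm (x y : G) : G := x * y * x^-1 * y^-1.

Definition is_subgroup (H : set G) : Prop :=
  [/\ H 1, forall x y, H x -> H y -> H (x * y) & forall x, H x -> H x^-1].

Definition generated (A : set G) : set G := smallest is_subgroup A.

Definition comm_subgroup (H K : set G) : set G :=
  generated [set z | exists x y, [/\ H x, K y & z = comm x y]].

(* The lower central series is indexed from 1; index 0 is a dummy, equal to
   the whole group. *)
Definition lower_central (n : nat) : set G :=
  iter n.-1 (fun H => comm_subgroup H [set: G]) [set: G].

Definition derived (n : nat) : set G :=
  iter n (fun H => comm_subgroup H H) [set: G].

Definition word_length (S : set G) (g : G) : nat :=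
  min_nat [set k | exists s : seq G,
    [/\ size s = k, forall x, x \in s -> S x & g = \prod_(x <- s) x]].

End GroupNotions.

(* The free group on two generators, as the group of reduced words. A letter is
   a pair (generator, is it inverted?). *)
Notation letter := (bool * bool)%type.

Definition linv (x : letter) : letter := (x.1, ~~ x.2).

Definition reduced (s : seq letter) : bool :=
  sorted (fun x y => y != linv x) s.

Definition push (x : letter) (s : seq letter) : seq letter :=
  if s is y :: s' then if y == linv x then s' else x :: s else [:: x].

Definition wmul (u v : seq letter) : seq letter := foldr push v u.

Definition winv (u : seq letter) : seq letter := rev (map linv u).

Lemma linvK : involutive linv.
Proof. by case=> g e; rewrite /linv /= negbK. Qed.

Lemma linv_neq x : linv x != x.
Proof. by case: x => [] [] []. Qed.

Lemma reduced_behead x s : reduced (x :: s) -> reduced s.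
Proof. by case: s => //= y s /andP[]. Qed.

Lemma reduced_push x s : reduced s -> reduced (push x s).
Proof.
case: s => //= y s rs; case: ifPn => [_|yx]; last by rewrite /= yx.
exact: (@reduced_behead y).
Qed.

Lemma reduced_wmul u v : reduced v -> reduced (wmul u v).
Proof. by move=> rv; elim: u => //= x u; exact: reduced_push. Qed.

Lemma push_linv x s : reduced s -> push x (push (linv x) s) = s.
Proof.
case: s => [|y s] /=; first by rewrite eqxx.
rewrite linvK; case: eqVneq => [-> | _ _]; last by rewrite /= eqxx.
by case: s => //= z s /andP[/negbTE ->].
Qed.

Lemma wmul_push x v w : reduced w -> wmul (push x v) w = push x (wmul v w).
Proof.
move=> rw; case: v => //= y v; case: eqVneq => [-> | _] //=.
by rewrite push_linv// reduced_wmul.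
Qed.

Lemma wmulA u v w : reduced w -> wmul u (wmul v w) = wmul (wmul u v) w.
Proof. by move=> rw; elim: u => //= x u ->; rewrite wmul_push. Qed.

Lemma wmulw1 u : reduced u -> wmul u [::] = u.
Proof.
elim: u => //= x u IH ru; rewrite IH; last exact: (@reduced_behead x).
by case: u ru {IH} => //= y u /andP[/negbTE ->].
Qed.

Lemma winvK : involutive winv.
Proof. by move=> u; rewrite /winv map_rev revK mapK //; exact: linvK. Qed.

Lemma reduced_winv u : reduced u -> reduced (winv u).
Proof.
rewrite /reduced /winv rev_sorted sorted_map; apply: sub_sorted => x y /=.
by rewrite linvK; apply: contraNN => /eqP <-.
Qed.

Lemma wmulVw u : wmul (winv u) u = [::].
Proof.
elim: u => //= x u IH.
by rewrite /winv /= rev_cons /wmul foldr_rcons /= linvK eqxx.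
Qed.

Record F2 := MkF2 { word :> seq letter; word_reduced : reduced word }.
HB.instance Definition _ := [isSub for word].
HB.instance Definition _ := [Choice of F2 by <:].

Definition F2_one : F2 := @MkF2 [::] isT.
Definition F2_mul (u v : F2) : F2 :=
  MkF2 (reduced_wmul (word u) (word_reduced v)).
Definition F2_inv (u : F2) : F2 := MkF2 (reduced_winv (word_reduced u)).

Lemma F2_mulA : associative F2_mul.
Proof. by move=> u v w; apply: val_inj; exact/wmulA/word_reduced. Qed.
Lemma F2_mul1 : left_id F2_one F2_mul.
Proof. by move=> u; apply: val_inj. Qed.
Lemma F2_mulr1 : right_id F2_one F2_mul.
Proof. by move=> u; apply: val_inj; exact/wmulw1/word_reduced. Qed.
Lemma F2_mulV : left_inverse F2_one F2_inv F2_mul.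
Proof. by move=> u; apply: val_inj; exact: wmulVw. Qed.
Lemma F2_mulrV : right_inverse F2_one F2_inv F2_mul.
Proof. by move=> u; apply: val_inj; rewrite /= -{1}[word u]winvK wmulVw. Qed.

HB.instance Definition _ :=
  isGroup.Build F2 F2_mulA F2_mul1 F2_mulr1 F2_mulV F2_mulrV.

Definition letter_F2 (x : letter) : F2 := @MkF2 [:: x] isT.
Definition gen_a : F2 := letter_F2 (false, false).
Definition gen_b : F2 := letter_F2 (true, false).

Section F2Facts.
Local Open Scope group_scope.

Lemma letter_F2V x : letter_F2 (linv x) = (letter_F2 x)^-1.
Proof. exact: val_inj. Qed.

Definition F2_gens : set F2 := [set gen_a; gen_a^-1; gen_b; gen_b^-1].

Definition F2_length (w : F2) : nat := word_length F2_gens w.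

Lemma F2_gensP (u : F2) : F2_gens u <-> exists x, u = letter_F2 x.
Proof.
rewrite /F2_gens /gen_a /gen_b -!letter_F2V; split.
  by move=> [[[|]|]|] ->; eexists.
by move=> [[[] []] ->]; [right | left; right | left; left; right | do 3 left].
Qed.

Lemma F2_prod_letters (u : F2) : u = \prod_(x <- word u) letter_F2 x.
Proof.
case: u => s rs /=; apply: val_inj => /=.
elim: s rs => [|x s IH] rs; first by rewrite big_nil.
have rs' := reduced_behead rs; rewrite big_cons /= -IH //.
by case: s rs {IH rs'} => //= y s /andP[/negbTE ->].
Qed.

Lemma size_push x s : (size (push x s) <= (size s).+1)%N.
Proof. by case: s => //= y s; case: ifP => //= _; rewrite !leqW. Qed.

Lemma F2_lengthE (w : F2) : F2_length w = size (word w).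
Proof.
rewrite /F2_length /word_length; set A := (X in min_nat X).
have Aw : A (size (word w)).
  exists [seq letter_F2 x | x <- word w].
  rewrite size_map big_map -F2_prod_letters; split => // u /mapP[x _ ->].
  by apply/F2_gensP; exists x.
have [[s [sE sS ws]] minA] := min_natP (ex_intro _ _ Aw).
apply/eqP; rewrite eqn_leq; apply/andP; split; first exact: minA Aw.
rewrite -sE ws.
elim: s sS {sE ws} => [_|u s IH sS]; first by rewrite big_nil.
have /F2_gensP[x ->] : F2_gens u by apply: sS; rewrite mem_head.
rewrite big_cons; apply: leq_trans (size_push _ _) _; apply: IH => v vs.
by apply: sS; rewrite in_cons vs orbT.
Qed.

(* The universal property of the free group. *)
Lemma F2_free (G : groupType) (x y : G) :
  exists! f : F2 -> G,
    [/\ {morph f : u v / u * v}, f gen_a = x & f gen_b = y].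
Proof.
pose h (l : letter) := let g := if l.1 then y else x in if l.2 then g^-1 else g.
have hV l : h (linv l) = (h l)^-1 by case: l => [] [] [] //=; rewrite /h /= invgK.
pose e (s : seq letter) := \prod_(l <- s) h l.
have eP l s : e (push l s) = h l * e s.
  rewrite /e; case: s => [|m s] /=; first by rewrite !big_cons.
  case: eqVneq => [->|_]; rewrite !big_cons // hV mulgA mulgV mul1g //.
exists (fun u : F2 => e (word u)); split.
  split => [[u ru] [v rv] /= {ru rv}||]; try by rewrite /e big_seq1.
  elim: u => [|l u IH] /=; first by rewrite {2}/e big_nil mul1g.
  by rewrite eP IH /e big_cons mulgA.
move=> f [fM fa fb]; apply/funext => u.
have f1 : f 1 = 1 by apply: (mulgI (f 1)); rewrite -fM !mulg1.
have fV v : f v^-1 = (f v)^-1 by apply: (mulgI (f v)); rewrite -fM !mulgV.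
have fl l : f (letter_F2 l) = h l.
  have hb b : f (letter_F2 (b, false)) = h (b, false) by case: b.
  by case: l => b []; rewrite ?hb // -[(b, true)]/(linv (b, false)) letter_F2V fV hV hb.
rewrite [in RHS](F2_prod_letters u) (big_morph f fM f1).
by apply: eq_bigr => l _; rewrite fl.
Qed.


End F2Facts.

Definition alpha (n : nat) : nat :=
  min_nat [set F2_length w | w in @lower_central F2 n `\ 1%g].

Definition beta (n : nat) : nat :=
  min_nat [set F2_length w | w in @derived F2 n `\ 1%g].

Local Open Scope ring_scope.

Section Asymptotics.
Variable R : realType.

Definition log2 (x : R) : R := ln x / ln 2.

Definition alpha_ratio (n : nat) : R := log2 (alpha n)%:R / log2 n%:R.
Definition beta_ratio (n : nat) : R := log2 (beta n)%:R / n%:R.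

Definition alpha_limit : R := limn alpha_ratio.
Definition beta_limit : R := limn beta_ratio.

(* [f] and [g] are functions on the positive integers, hence the restriction
   to positive [n] and to a positive integer [C]. *)
Definition preceq (f g : nat -> R) : Prop :=
  exists2 C : nat, (0 < C)%N &
    forall n : nat, (0 < n)%N -> f n <= C%:R * g (C * n)%N.

Definition is_o_n (h : nat -> R) : Prop := h n / n%:R @[n --> \oo] --> 0.

End Asymptotics.

(* Main.v *)
Require Import Defs.
From Stdlib Require Import NArith.
From mathcomp Require Import all_boot all_order all_algebra all_fingroup.
From mathcomp Require Import all_classical all_reals all_analysis.
From mathcomp Require Import zify ring lra.
Set Implicit Arguments.
Unset Strict Implicit.
Unset Printing Implicit Defensive.
Import Order.TTheory GRing.Theory Num.Theory.
Import numFieldNormedType.Exports.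
Local Open Scope classical_set_scope.
Local Open Scope ring_scope.

(* Upper bounds. The endomorphism [phi] of the free group sending [a] to
   [[b^-1, a]] and [b] to [[a, b]] is injective, and [phi^n(a)] lies in the
   [n]-th derived subgroup. Applying [phi] to a reduced word cancels exactly two
   letters at each subword [ab] or [b^-1 a^-1], so length and number of such
   subwords evolve linearly, with dominant eigenvalue [x = (3 + sqrt 17) / 2].
   Since [phi^(n+2)(b) = [[phi^n(b)^-1, phi^(n+1)(b)], phi^(n+1)(b)]], the
   elements [phi^n(a)], [phi^n(b)] lie in the term of the lower central series
   whose index is a Pell number, of order [(1 + sqrt 2)^n].

   Lower bound. Let [N] be normal with shortest nontrivial length [m], and [w] a
   shortest nontrivial element of [[N, N]]. In the Cayley graph of the quotient
   by [N], the closed path [w] has zero net flow along every edge, and this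
   forces it to visit some vertex three times; two visits are at distance at
   least [m] along the path, so [w] has length at least [3 m].

   Limits. Conjugating a shortest element of a normal subgroup by two suitable
   letters gives a free pair of the same length up to a constant. Substituting
   it into another shortest element makes [alpha] and [beta] submultiplicative
   up to a constant factor, and Fekete's argument applies. *)

(** * Commutator subgroups and the two series *)

Section Morphisms.
Local Open Scope group_scope.
Context {G G' : groupType} (f : G -> G').
Hypothesis fM : {morph f : x y / x * y}.

Lemma morph_one : f 1 = 1.
Proof. by apply: (mulgI (f 1)); rewrite -fM !mulg1. Qed.

Lemma morph_inv x : f x^-1 = (f x)^-1.
Proof. by apply: (mulgI (f x)); rewrite -fM !mulgV morph_one. Qed.

Lemma morph_comm x y : f (comm x y) = comm (f x) (f y).
Proof. by rewrite /comm !fM !morph_inv. Qed.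

Lemma subgroup_preimage (H : set G') :
  is_subgroup H -> is_subgroup (f @^-1` H).
Proof.
move=> [H1 HM HV]; split=> [|x y Hx Hy|x Hx] /=; first by rewrite morph_one.
  by rewrite fM; apply: HM.
by rewrite morph_inv; apply: HV.
Qed.

End Morphisms.

Section CommutatorSubgroups.
Local Open Scope group_scope.
Context {G : groupType}.
Implicit Types (H K M : set G) (x y z : G).

Definition conj_closed H := forall g x, H x -> H (g * x * g^-1).

Lemma conjM g : {morph (fun x => g * x * g^-1) : x y / x * y}.
Proof. by move=> x y; rewrite !mulgA mulgVK. Qed.

Lemma subgroup_setT : is_subgroup [set: G].
Proof. by split. Qed.

Lemma subgroup_comm_subgroup H K : is_subgroup (comm_subgroup H K).
Proof.
split=> [|x y Sx Sy|x Sx] M [sM AM]; have [M1 MM MV] := sM; first exact: M1.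
  by apply: MM; [apply: Sx | apply: Sy].
by apply: MV; apply: Sx.
Qed.

Lemma mem_comm_subgroup H K x y : H x -> K y -> comm_subgroup H K (comm x y).
Proof. by move=> Hx Ky M [_]; apply; exists x, y. Qed.

Lemma comm_subgroup_sub H K M : is_subgroup M ->
  (forall x y, H x -> K y -> M (comm x y)) -> comm_subgroup H K `<=` M.
Proof.
move=> sM HKM x; apply; split=> // _ [y [z [Hy Kz ->]]]; exact: HKM.
Qed.

Lemma comm_subgroup_conj H K : conj_closed H -> conj_closed K ->
  conj_closed (comm_subgroup H K).
Proof.
move=> nH nK g.
set M := comm_subgroup H K.
suff : M `<=` [set x | M (g * x * g^-1)] by [].
apply: comm_subgroup_sub => [|x y Hx Ky] /=.
  exact: (subgroup_preimage (conjM g) (subgroup_comm_subgroup H K)).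
by rewrite (morph_comm (conjM g)); apply: mem_comm_subgroup; [apply: nH|apply: nK].
Qed.

Lemma subgroup_derived n : is_subgroup (@derived G n).
Proof. by case: n => [|n]; [apply: subgroup_setT|apply: subgroup_comm_subgroup]. Qed.

Lemma derived_conj n : conj_closed (@derived G n).
Proof. by elim: n => [//|n IH]; apply: comm_subgroup_conj. Qed.

Lemma derivedS n : @derived G n.+1 `<=` @derived G n.
Proof.
apply: comm_subgroup_sub => [|x y]; first exact: subgroup_derived.
have [_ DM DV] := subgroup_derived n; move=> Dx Dy.
by apply: (DM); [apply: (DM); [apply: (DM)|apply: (DV)]|apply: (DV)].
Qed.

Lemma derived_sub m n : (m <= n)%N -> @derived G n `<=` @derived G m.
Proof.
move=> /subnK <-; elim: (n - m)%N => [//|k IH].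
exact: subset_trans (@derivedS _) IH.
Qed.

Lemma lower_centralS n : (0 < n)%N ->
  @lower_central G n.+1 = comm_subgroup (lower_central n) [set: G].
Proof. by case: n. Qed.

Lemma subgroup_lower_central n : is_subgroup (@lower_central G n).
Proof.
by case: n => [|[|n]]; [exact: subgroup_setT..|exact: subgroup_comm_subgroup].
Qed.

Lemma lower_central_conj n : conj_closed (@lower_central G n).
Proof.
case: n => [//|]; elim=> [//|n IH]; rewrite lower_centralS //.
exact: comm_subgroup_conj.
Qed.

Lemma lower_central_sub m n : (m <= n)%N ->
  @lower_central G n `<=` @lower_central G m.
Proof.
move=> /subnK <-; elim: (n - m)%N => [//|k IH]; rewrite addSn.
apply: subset_trans IH; case: (posnP (k + m)) => [->//|k0].
rewrite lower_centralS //; apply: comm_subgroup_sub => [|x y Cx _].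
  exact: subgroup_lower_central.
have [_ CM CV] := subgroup_lower_central (k + m).
rewrite /comm -!mulgA (mulgA y); apply: CM => //; apply: lower_central_conj.
exact: CV.
Qed.

Lemma comm_inv x y : (comm x y)^-1 = comm y x.
Proof. by rewrite /comm !invgM !invgK !mulgA. Qed.

(** Lets commutators with a generated subgroup be tested on its generators; closure under products
    comes from [[x, yz] = [x, y] y[x, z]y^-1]. *)
Lemma subgroup_commr H M : is_subgroup M -> conj_closed M ->
  is_subgroup [set z | forall x, H x -> M (comm x z)].
Proof.
move=> [M1 MM MV] nM; split=> [x Hx|y z Cy Cz x Hx|z Cz x Hx] /=.
- by rewrite /comm mulg1 mulgV invg1 mulg1.
- suff -> : comm x (y * z) = comm x y * (y * comm x z * y^-1).
    by apply: MM; [apply: Cy|apply/nM/Cz].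
  by rewrite /comm invgM !mulgA !mulgVK.
- suff -> : comm x z^-1 = z^-1 * (comm x z)^-1 * z^-1^-1 by apply/nM/MV/Cz.
  by rewrite /comm !invgM !invgK !mulgA mulVg mul1g.
Qed.

Lemma hall_witt x y z :
  (x * comm (comm x^-1 y) z * x^-1) * (z * comm (comm z^-1 x) y * z^-1)
    * (y * comm (comm y^-1 z) x * y^-1) = 1.
Proof.
rewrite /comm !invgM !invgK !mulgA.
by do ![rewrite mulgVK | rewrite mulgK | rewrite mulgV | rewrite mul1g].
Qed.

(** Induction on [j]. For a generator [[y, f]] of the next term, Hall-Witt expresses [[[y, f], x]]
    through conjugates of [[[x^-1, y^-1], f]] and [[[f^-1, x], y^-1]], both of the desired depth. *)
Lemma comm_lower_central i j x y : (0 < i)%N -> (0 < j)%N ->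
  lower_central i x -> lower_central j y -> lower_central (i + j) (comm x y).
Proof.
case: j => // j + _; elim: j i x y => [|j IH] i x y i0 Cx.
  by move=> _; rewrite addn1 lower_centralS//; apply: mem_comm_subgroup.
have sC k := subgroup_lower_central k; have nC k := @lower_central_conj k.
have CV k z : lower_central k z -> lower_central k z^-1 by have [_ _] := sC k; apply.
suff : lower_central j.+2 `<=`
    [set z | forall x, lower_central i x -> lower_central (i + j.+2) (comm x z)].
  by move=> /[apply]; apply.
rewrite lower_centralS//; apply: comm_subgroup_sub; first exact: subgroup_commr.
move=> {Cx}y f Cy _ {}x Cx; rewrite -comm_inv; apply: (CV).
have /(canRL (mulKg _))/(canRL (mulgK _))/(canRL (mulKg _)) := hall_witt x y^-1 f.
rewrite !invgK mulg1 => ->; rewrite mulgA; apply: (nC); apply: (CV).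
rewrite addnS -addSn; have [_ CM _] := sC (i.+1 + j.+1)%N; apply: CM; apply: (nC).
  rewrite addSn lower_centralS; last by rewrite ltn_addr.
  by apply: mem_comm_subgroup => //; apply: (IH) => //; apply: (CV).
apply: (IH) => //; last exact: (CV).
by rewrite -comm_inv; apply: (CV); rewrite lower_centralS//; apply: mem_comm_subgroup.
Qed.

End CommutatorSubgroups.

Section MorphismSeries.
Local Open Scope group_scope.
Context {G G' : groupType} (f : G -> G').
Hypothesis fM : {morph f : x y / x * y}.

Lemma morph_derived m n : (forall x, derived m (f x)) ->
  forall x, derived n x -> derived (m + n) (f x).
Proof.
move=> fm; elim: n => [|n IH] x; first by rewrite addn0.
suff : derived n.+1 `<=` f @^-1` derived (m + n.+1) by apply.
rewrite addnS; apply: comm_subgroup_sub => [|{}x y Dx Dy] /=.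
  exact: (subgroup_preimage fM (subgroup_comm_subgroup _ _)).
by rewrite (morph_comm fM); apply: mem_comm_subgroup; apply: IH.
Qed.

(** Each commutator step in the source adds [m] to the index, because its second entry is also
    mapped into term [m]. *)
Lemma morph_lower_central m n : (0 < m)%N -> (0 < n)%N ->
  (forall x, lower_central m (f x)) ->
  forall x, lower_central n x -> lower_central (m * n) (f x).
Proof.
move=> m0 + fm; case: n => // n _; elim: n => [|n IH] x; first by rewrite muln1.
suff : lower_central n.+2 `<=` f @^-1` lower_central (m * n.+2) by apply.
rewrite lower_centralS //; apply: comm_subgroup_sub => [|{}x y Dx _] /=.
  exact: (subgroup_preimage fM (subgroup_lower_central _)).
rewrite (morph_comm fM) [(_ * n.+2)%N]mulnS addnC; apply: comm_lower_central => //.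
  by rewrite muln_gt0 m0.
exact: IH.
Qed.

End MorphismSeries.

(** * Substitutions and the endomorphism phi *)

Lemma size_wmul u v : (size (wmul u v) <= size u + size v)%N.
Proof.
elim: u => //= x u IH; rewrite addSn.
exact: leq_trans (size_push _ _) _.
Qed.

Lemma wmul_cat u v : reduced (u ++ v) -> wmul u v = u ++ v.
Proof.
elim: u => //= x u IH ruv; rewrite IH; last exact: (@reduced_behead x).
by case: (u ++ v) ruv {IH} => //= y s /andP[/negbTE ->].
Qed.

Section Substitution.
Local Open Scope group_scope.
Variable h : letter -> F2.

Definition subst (w : F2) : F2 := \prod_(l <- word w) h l.

Definition subst_word (s : seq letter) : seq letter :=
  foldr (fun l => wmul (word (h l))) [::] s.

Lemma word_subst w : word (subst w) = subst_word (word w).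
Proof.
rewrite /subst; elim: (word w) => [|l s IH]; first by rewrite big_nil.
by rewrite big_cons /= IH.
Qed.

Lemma subst_letter l : subst (letter_F2 l) = h l.
Proof. by rewrite /subst big_seq1. Qed.

Lemma size_subst k w : (forall l, size (word (h l)) <= k)%N ->
  (size (word (subst w)) <= size (word w) * k)%N.
Proof.
move=> hk; rewrite word_subst; elim: (word w) => //= l s IH.
by apply: leq_trans (size_wmul _ _) _; rewrite mulSn leq_add.
Qed.

Hypothesis hV : forall l, h (linv l) = (h l)^-1.

Lemma substM : {morph subst : u v / u * v}.
Proof.
move=> [u ru] [v rv]; rewrite /subst /= {ru rv}; elim: u => [|l u IH] /=.
  by rewrite big_nil mul1g.
rewrite big_cons -mulgA -IH; case: (wmul u v) => [|m s] /=.
  by rewrite !big_cons.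
by case: eqVneq => [->|_]; rewrite !big_cons // hV mulgA mulgV mul1g.
Qed.

(* [pre l] is a prefix of [h l] that survives multiplication by any [h l'] with
   [l'] not inverse to [l]. *)
Variable pre : letter -> seq letter.
Hypothesis pre_h : forall l, exists t, word (h l) = pre l ++ t.
Hypothesis preM : forall l l' t, l' != linv l -> reduced (pre l' ++ t) ->
  exists t', wmul (word (h l)) (pre l' ++ t) = pre l ++ t'.

Lemma subst_word_prefix l s :
  reduced (l :: s) -> exists t, subst_word (l :: s) = pre l ++ t.
Proof.
elim: s l => [|l' s IH] l rs.
  by have [t E] := pre_h l; exists t; rewrite /= wmulw1 ?word_reduced.
have [|t E] := IH l'; first exact: (@reduced_behead l).
rewrite -[subst_word _]/(wmul (word (h l)) (subst_word (l' :: s))) E.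
have rs' := reduced_behead rs.
apply: preM; first by case/andP: rs.
by rewrite -E -(word_subst (MkF2 rs')) word_reduced.
Qed.

Lemma subst_neq1 w : (forall l, pre l != [::]) -> w != 1 -> subst w != 1.
Proof.
move=> pre0; apply: contraNneq => /(congr1 word); rewrite word_subst.
case: w => [[|l s] rs] /=; first by move=> _; apply/eqP/val_inj.
have [t] := subst_word_prefix rs; rewrite -/(subst_word s) => /= -> /eqP.
by case: (pre l) (pre0 l).
Qed.

End Substitution.

Section Phi.
Local Open Scope group_scope.

Definition extend (u v : F2) (l : letter) : F2 :=
  let g := if l.1 then v else u in if l.2 then g^-1 else g.

Lemma extendV u v l : extend u v (linv l) = (extend u v l)^-1.
Proof. by case: l => [] [] []; rewrite /extend /= ?invgK. Qed.

Definition phi_letter := extend (comm gen_b^-1 gen_a) (comm gen_a gen_b).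
Definition phi := subst phi_letter.

Lemma phiM : {morph phi : u v / u * v}.
Proof. exact/substM/extendV. Qed.

Lemma phi_gen_a : phi gen_a = comm gen_b^-1 gen_a.
Proof. by rewrite /phi subst_letter. Qed.

Lemma phi_gen_b : phi gen_b = comm gen_a gen_b.
Proof. by rewrite /phi subst_letter. Qed.

(** Counts the subwords [ab] and [b^-1 a^-1], where the images of adjacent letters under [phi]
    cancel. *)
Fixpoint turns (s : seq letter) : nat :=
  if s is x :: s' then
    ((if s' is y :: _ then (x.1 == x.2) && (y == (~~ x.1, x.2)) else false)
      + turns s')%N
  else 0%N.

Lemma turns_le s : (turns s <= size s)%N.
Proof.
elim: s => //= x s IH; rewrite -add1n leq_add //.
by case: s {IH} => //= y s; case: (_ && _).
Qed.

(** The first half of each four-letter image; what follows on the right cancels at most the last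
    letter of that image. *)
Definition phi_pre (l : letter) : seq letter :=
  match l with
  | (false, false) => [:: (true, true); (false, false)]
  | (false, true) => [:: (false, false); (true, true)]
  | (true, false) => [:: (false, false); (true, false)]
  | (true, true) => [:: (true, false); (false, false)]
  end.

Definition turn (l l' : letter) : bool := (l.1 == l.2) && (l' == (~~ l.1, l.2)).

(** Each image contains one counted subword. At a turn, one letter of each image cancels and one
    counted subword is lost; the other junctions create none. *)
Lemma phi_pre_mul l l' t : l' != linv l ->
  exists t', [/\ wmul (word (phi_letter l)) (phi_pre l' ++ t) = phi_pre l ++ t',
    (size (phi_pre l ++ t') + 2 * turn l l' = 4 + size (phi_pre l' ++ t))%N &
    (turns (phi_pre l ++ t') + turn l l' = 1 + turns (phi_pre l' ++ t))%N].
Proof.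
by case: l => [] [] []; case: l' => [] [] [] //= _;
  (eexists; split; [reflexivity|rewrite /turn /=; lia..]).
Qed.

Lemma phi_word l s : reduced (l :: s) ->
  (size (subst_word phi_letter (l :: s)) + 2 * turns (l :: s) = 4 * size (l :: s) /\
  turns (subst_word phi_letter (l :: s)) + turns (l :: s) = size (l :: s))%N.
Proof.
elim: s l => [|l' s IH] l rs; first by case: l rs => [] [] [].
have rs' := reduced_behead rs; have [IH1 IH2] := IH _ rs'.
have [|l1|t E] := @subst_word_prefix phi_letter phi_pre _ _ l' s rs'.
- by move=> [[] []]; eexists; reflexivity.
- by move=> l2 t l12 _; have [t' [-> _ _]] := phi_pre_mul t l12; exists t'.
have /(phi_pre_mul t) [t' [E' S T]] : l' != linv l by case/andP: rs.
rewrite -[subst_word _ (l :: _)]/(wmul (word (phi_letter l)) (subst_word phi_letter (l' :: s))).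
rewrite E E'; move: IH1 IH2 S T; rewrite E /turn /=; lia.
Qed.

Lemma phi_size w :
  (size (phi w) + 2 * turns w = 4 * size w /\ turns (phi w) + turns w = size w)%N.
Proof.
rewrite /phi word_subst; case: w => [[|l s] rs] //=; exact: (phi_word rs).
Qed.

Lemma phi_neq1 w : w != 1 -> phi w != 1.
Proof.
apply: (@subst_neq1 _ phi_pre).
- by move=> [[] []]; eexists; reflexivity.
- by move=> l1 l2 t l12 _; have [t' [-> _ _]] := phi_pre_mul t l12; exists t'.
- by move=> [[] []].
Qed.

End Phi.

Section Depth.
Local Open Scope group_scope.

Lemma subst_subgroup (h : letter -> F2) (H : set F2) w :
  is_subgroup H -> (forall l, H (h l)) -> H (subst h w).
Proof.
move=> [H1 HM _] Hh; rewrite /subst; elim: (word w) => [|l s IH].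
  by rewrite big_nil.
by rewrite big_cons; apply: HM.
Qed.

Lemma extend_subgroup u v (H : set F2) l :
  is_subgroup H -> H u -> H v -> H (extend u v l).
Proof. by move=> [_ _ HV] Hu Hv; case: l => [] [] []; rewrite /extend //=; apply: HV. Qed.

Lemma iter_phiM n : {morph iter n phi : u v / u * v}.
Proof. by elim: n => // n IH u v /=; rewrite IH phiM. Qed.

Lemma iter_phi_neq1 n w : w != 1 -> iter n phi w != 1.
Proof. by move=> w1; elim: n => //= n; apply: phi_neq1. Qed.

Lemma iter_phi_derived n w : derived n (iter n phi w).
Proof.
(* The innermost [phi] lands in the first derived subgroup, and the other [n] iterates raise the
   depth by [n]. *)
elim: n w => // n IH w; rewrite iterSr -addn1.
apply: (morph_derived (iter_phiM n) IH); have sD := @subgroup_derived F2 1.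
apply: (subst_subgroup _ sD) => l.
by apply: (extend_subgroup _ sD); apply: mem_comm_subgroup.
Qed.

(** The Pell numbers shifted by one, so that [pell 0 = 1] is the depth of [phi^0(b) = b]. *)
Fixpoint pell (n : nat) : nat :=
  match n with
  | 0 => 1
  | 1 => 2
  | (n'.+1 as m).+1 => 2 * pell m + pell n'
  end.

Lemma pell_gt0 n : (0 < pell n)%N.
Proof. by elim/ltn_ind: n => [[|[|n]]] // IH; rewrite addn_gt0 IH ?orbT. Qed.

Lemma iter_phi_a n :
  iter n.+1 phi gen_a = comm (iter n phi gen_b)^-1 (iter n phi gen_a).
Proof.
by rewrite iterSr phi_gen_a (morph_comm (iter_phiM n)) (morph_inv (iter_phiM n)).
Qed.

Lemma iter_phi_b n :
  iter n.+1 phi gen_b = comm (iter n phi gen_a) (iter n phi gen_b).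
Proof. by rewrite iterSr phi_gen_b (morph_comm (iter_phiM n)). Qed.

(* [a_(n+1)] is the conjugate of [b_(n+1)] by [b_n^-1], so that
   [b_(n+2) = [a_(n+1), b_(n+1)] = [[b_n^-1, b_(n+1)], b_(n+1)]]. *)
Lemma iter_phi_aE n : iter n.+1 phi gen_a =
  (iter n phi gen_b)^-1 * iter n.+1 phi gen_b * iter n phi gen_b.
Proof. by rewrite iter_phi_a iter_phi_b /comm invgK !mulgA mulgVK. Qed.

Lemma iter_phi_bE n : iter n.+2 phi gen_b =
  comm (comm (iter n phi gen_b)^-1 (iter n.+1 phi gen_b)) (iter n.+1 phi gen_b).
Proof.
rewrite iter_phi_b iter_phi_aE /comm !invgM !invgK !mulgA.
by rewrite !mulgVK.
Qed.

(** In [iter_phi_bE] the entry [phi^(n+1)(b)] occurs twice and [phi^n(b)] once, so depths add up as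
    in the Pell recursion. *)
Lemma iter_phi_lower_central_b n : lower_central (pell n) (iter n phi gen_b).
Proof.
elim/ltn_ind: n => [[|[|n]]] IH //.
  by rewrite iter_phi_b; apply: mem_comm_subgroup.
rewrite iter_phi_bE.
have -> : pell n.+2 = (pell n + pell n.+1 + pell n.+1)%N.
  by rewrite -[LHS]/(2 * pell n.+1 + pell n)%N; lia.
have [_ _ CV] := @subgroup_lower_central F2 (pell n).
have CS := IH n.+1 (ltnSn _).
apply: comm_lower_central => //; rewrite ?addn_gt0 ?pell_gt0 //.
by apply: comm_lower_central; rewrite ?pell_gt0 //; apply: CV; apply: IH.
Qed.

Lemma iter_phi_lower_central_a n : lower_central (pell n) (iter n phi gen_a).
Proof.
case: n => // n; rewrite iter_phi_aE -{2}[iter n phi gen_b]invgK.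
by apply: lower_central_conj; apply: iter_phi_lower_central_b.
Qed.

End Depth.

Section GrowthRoot.
Variable R : realType.

Definition growth : R := (3 + Num.sqrt 17) / 2.

Lemma growth_root : growth ^+ 2 = 3 * growth + 2.
Proof.
have : (Num.sqrt 17 : R) ^+ 2 = 17 by rewrite sqr_sqrtr.
by rewrite /growth => h; field: h.
Qed.

Lemma sqrt_lb (x y : R) : 0 <= x -> x ^+ 2 <= y -> x <= Num.sqrt y.
Proof. by move=> x0 xy; rewrite -[leLHS]ger0_norm// -sqrtr_sqr ler_wsqrtr. Qed.

Lemma sqrt_ub (x y : R) : 0 <= x -> y <= x ^+ 2 -> Num.sqrt y <= x.
Proof. by move=> x0 xy; rewrite -[leRHS]ger0_norm// -sqrtr_sqr ler_wsqrtr. Qed.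

(** Here [268/65], and below [2177/528], are consecutive continued fraction convergents to the
    square root of 17. *)
Lemma growth_lb : 463 / 130 <= growth.
Proof.
have : 268 / 65 <= Num.sqrt (17 : R) by apply: sqrt_lb; lra.
rewrite /growth; lra.
Qed.

Lemma growth_ub : growth <= 3761 / 1056.
Proof.
have : Num.sqrt (17 : R) <= 2177 / 528 by apply: sqrt_ub; lra.
rewrite /growth; lra.
Qed.

(* [(1, growth - 4)] is a left eigenvector of the transition matrix of
   [phi_size]. *)
Lemma size_iter_phi n :
  (size (iter n phi gen_a))%:R + (growth - 4) * (turns (iter n phi gen_a))%:R
  = growth ^+ n.
Proof.
elim: n => [|n IH]; first by rewrite /= mulr0 addr0 expr0.
rewrite exprS -IH /=; set w := iter n phi gen_a.
have [S T] := phi_size w.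
have {}S : (size (phi w))%:R = 4 * (size w)%:R - 2 * (turns w)%:R :> R.
  by apply/eqP; rewrite eq_sym subr_eq -!natrM -natrD -S.
have {}T : (turns (phi w))%:R = (size w)%:R - (turns w)%:R :> R.
  by apply/eqP; rewrite eq_sym subr_eq -natrD -T.
rewrite S T; have := growth_root; move: growth (size w)%:R (turns w)%:R => x s t h.
apply/eqP; rewrite -subr_eq0; apply/eqP.
transitivity (t * (3 * x + 2 - x ^+ 2)); first by ring.
by rewrite h; ring.
Qed.

(** The coefficient [growth - 4] is negative, but [turns] is at most the size, so the weighted sum
    is at least [growth - 3 > 1/2] times the size. *)
Lemma size_iter_phi_le n : (size (iter n phi gen_a))%:R <= 2 * growth ^+ n.
Proof.
rewrite -size_iter_phi; set w := iter n phi gen_a.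
have : (turns w)%:R <= (size w)%:R :> R by rewrite ler_nat turns_le.
have : 0 <= (turns w)%:R :> R by [].
have := growth_lb; move: growth (size w)%:R (turns w)%:R => x s t; nra.
Qed.

End GrowthRoot.

(** * Free pairs and submultiplicativity *)

Section FreePair.
Local Open Scope group_scope.

Lemma word_eq1 (w : F2) : (word w == [::]) = (w == 1).
Proof. by apply/eqP/eqP => [w1|->//]; apply/val_inj. Qed.

Lemma reduced_cat_cons x s y t : reduced (x :: s ++ y :: t) =
  [&& reduced (x :: s), y != linv (last x s) & reduced (y :: t)].
Proof. by rewrite /reduced /= cat_path. Qed.

Lemma winv_cons f s : exists2 t,
  winv (f :: s) = linv (last f s) :: t & last (linv (last f s)) t = linv f.
Proof.
rewrite /winv /=; case/lastP: s => [|s e]; first by exists [::].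
rewrite last_rcons rev_cons map_rcons rev_rcons /=; eexists; first reflexivity.
by rewrite last_rcons.
Qed.

(** Each condition on [z] excludes one of the four letters, so at least two remain. *)
Lemma two_letters (f e : letter) : exists x y, x != y /\
  (forall z, z \in [:: x; y] -> (f != linv z) && (e != z)).
Proof.
have H x y : [&& x != y, f != linv x, e != x, f != linv y & e != y] ->
    exists x y, x != y /\
    (forall z, z \in [:: x; y] -> (f != linv z) && (e != z)).
  move=> /and5P[xy fx ex fy ey]; exists x, y; split=> // z.
  by rewrite !inE => /orP[] /eqP ->; apply/andP.
move: f e H => [[] []] [[] []] H;
  first [ exact: (H (true, true) (true, false))
        | exact: (H (true, true) (false, false))
        | exact: (H (true, true) (false, true))
        | exact: (H (true, false) (false, false))
        | exact: (H (true, false) (false, true))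
        | exact: (H (false, false) (false, true))].
Qed.

Variable N : set F2.
Hypotheses (N1 : is_subgroup N) (NJ : conj_closed N).

(* A shortest nontrivial element [w] is cyclically reduced, hence so are its
   powers; conjugating [w] by two letters that do not cancel against its ends
   gives a free pair. *)
Lemma short_free_pair w : N w -> w != 1 ->
  (forall v, N v -> v != 1 -> (size w <= size v)%N) ->
  exists h : letter -> F2,
  [/\ forall l, h (linv l) = (h l)^-1,
      forall l, N (h l),
      forall l, (size (h l) <= (size w).+2)%N &
      forall v, v != 1 -> subst h v != 1].
Proof.
move=> Nw w1 minw.
have [f [s Ew]] : exists f s, word w = f :: s.
  by move: w1; rewrite -word_eq1; case: (word w) => // f s _; exists f, s.
have rw : reduced (f :: s) by rewrite -Ew word_reduced.
pose e := last f s.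
(* Otherwise conjugation by [f^-1] strips both ends of [w] and leaves a shorter nontrivial element
   of [N]. *)
have fe : f != linv e.
  apply/eqP => Ef; have {}Ef : e = linv f by rewrite Ef linvK.
  move: Ef rw Ew; rewrite /e {e}; case/lastP: s => [|s e] /=.
    by move=> /esym/eqP; rewrite (negbTE (linv_neq _)).
  rewrite last_rcons => -> {e} rw Ew.
  have rs : reduced s.
    by move: rw; rewrite -cats1 /reduced /= cat_path => /andP[/path_sorted].
  have Es : letter_F2 (linv f) * w * (letter_F2 (linv f))^-1 = MkF2 rs.
    have -> : w = letter_F2 f * (MkF2 rs * letter_F2 (linv f)).
      apply/val_inj; rewrite /= Ew; move: rw; rewrite -cats1 => rw.
      rewrite wmul_cat; last exact: reduced_behead rw.
      exact/esym/(@wmul_cat [:: f]).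
    by rewrite letter_F2V invgK !mulgA mulVg mul1g mulgVK.
  have := NJ (letter_F2 (linv f)) Nw; rewrite Es => /minw.
  rewrite -word_eq1 Ew /= size_rcons.
  suff -> : s != [::] by move/(_ isT); lia.
  by case: s rw {Ew rs Es} => //=; rewrite eqxx.
have [x [y [xy Hxy]]] := two_letters f e.
pose X (l : letter) := if l.1 then y else x.
pose W (l : letter) := if l.2 then w^-1 else w.
have HX l : (f != linv (X l)) && (e != X l).
  by apply: Hxy; rewrite /X !inE; case: ifP => _; rewrite eqxx ?orbT.
have [s' Ew' Es'] : exists2 s', word w^-1 = linv e :: s' & last (linv e) s' = linv f.
  by rewrite /= Ew; apply: winv_cons.
(* [W l] cancels neither against its conjugating letters nor against a copy of itself. *)
have WE l : exists f1 s1, [/\ word (W l) = f1 :: s1,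
    f1 != linv (X l), linv (X l) != linv (last f1 s1) & f1 != linv (last f1 s1)].
  have /andP[fX eX] := HX l; rewrite /W; case: ifP => _.
    exists (linv e), s'; rewrite Es' linvK !(inj_eq (inv_inj linvK)).
    by rewrite eX eq_sym fX eq_sym fe.
  by exists f, s; rewrite fX (inj_eq (inv_inj linvK)) eq_sym eX fe.
pose h := extend (letter_F2 x * w * (letter_F2 x)^-1) (letter_F2 y * w * (letter_F2 y)^-1).
have hE l : h l = letter_F2 (X l) * W l * (letter_F2 (X l))^-1.
  by rewrite /h /extend /X /W; case: l => [] [] [] //=; rewrite !invgM invgK mulgA.
have wE l : word (h l) = X l :: word (W l) ++ [:: linv (X l)].
  have [f1 [s1 [E F1 L1 _]]] := WE l.
  rewrite hE -letter_F2V -mulgA /=.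
  have r : reduced (X l :: word (W l) ++ [:: linv (X l)]).
    rewrite E reduced_cat_cons /= F1 L1 !andbT.
    by have := word_reduced (W l); rewrite E.
  rewrite wmul_cat; last exact: reduced_behead r.
  exact: (@wmul_cat [:: X l]).
exists h; split.
- exact: extendV.
- by move=> l; rewrite hE /W; apply: NJ; case: ifP => // _; have [_ _] := N1; apply.
- move=> l; rewrite wE /= size_cat addn1 /W; case: ifP => //= _.
  by rewrite size_rev size_map.
move=> v; apply: (@subst_neq1 _ (fun l => X l :: word (W l))) => [l|l l' t ll' r|//].
  by rewrite wE; eexists; reflexivity.
rewrite wE; have [f1 [s1 [E F1 L1 C1]]] := WE l.
have rX : reduced (X l :: word (W l)).
  by rewrite E /= F1; have := word_reduced (W l); rewrite E.
(* Equal conjugating letters force [l' = l]; they cancel, and two copies of [W l] join without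
   cancellation. Distinct ones leave the product reduced. *)
case: (eqVneq (X l) (X l')) => [XX|XX].
  have El : l' = l.
    move: ll' XX; rewrite /X; case: (l) (l') => [b c] [b' c'].
    case: b b' => [] [] /=; case: c c' => [] [] //= _ /eqP;
    by rewrite ?(negbTE xy) // eq_sym (negbTE xy).
  move: r; rewrite El => r; exists (word (W l) ++ t).
  have -> u : wmul (X l :: word (W l) ++ [:: linv (X l)]) u =
      wmul (X l :: word (W l)) (push (linv (X l)) u).
    by rewrite /wmul /= foldr_cat.
  rewrite [push _ _]/= linvK eqxx wmul_cat //.
  have {}r : reduced (X l :: word (W l) ++ t) := r.
  move: rX r; rewrite E => rX r.
  rewrite -[_ ++ _]/(X l :: (f1 :: s1) ++ f1 :: (s1 ++ t)).
  rewrite reduced_cat_cons rX C1 /=.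
  exact: (reduced_behead r).
exists (linv (X l) :: X l' :: word (W l') ++ t).
rewrite wmul_cat; first by rewrite /= -catA.
rewrite reduced_cat_cons; apply/and3P; split=> //.
- rewrite E reduced_cat_cons /= L1 andbT.
  by rewrite -/(reduced (f1 :: s1)) andbT; move: rX; rewrite E.
- by rewrite last_cat /= linvK eq_sym.
Qed.

End FreePair.

Section ShortestElements.
Local Open Scope group_scope.

Lemma ltn_pell n : (n < pell n)%N.
Proof.
elim/ltn_ind: n => [[|[|n]]] // IH.
rewrite -[pell n.+2]/(2 * pell n.+1 + pell n)%N.
have := IH n.+1 (ltnSn _); lia.
Qed.

Lemma gen_a_neq1 : gen_a != 1.
Proof. by []. Qed.

(** Makes [beta] a true minimum, since [min_nat] defaults to 0 on the empty set. *)
Lemma derived_neq0 n : (@derived F2 n `\ 1) !=set0.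
Proof.
exists (iter n phi gen_a); split; first exact: iter_phi_derived.
by apply/eqP/iter_phi_neq1/gen_a_neq1.
Qed.

Lemma lower_central_neq0 n : (@lower_central F2 n `\ 1) !=set0.
Proof.
exists (iter n phi gen_a); split; last by apply/eqP/iter_phi_neq1/gen_a_neq1.
exact: lower_central_sub (ltnW (ltn_pell n)) _ (iter_phi_lower_central_a n).
Qed.

Lemma min_lengthP (H : set F2) : (H `\ 1) !=set0 ->
  let m := min_nat [set F2_length w | w in H `\ 1] in
  (exists w : F2, [/\ H w, w != 1 & size w = m]) /\
  forall w, H w -> w != 1 -> (m <= size w)%N.
Proof.
move=> [w0 Hw0] m.
have [[w [Hw /eqP w1] wm] lbm] :=
  @min_natP [set F2_length w | w in H `\ 1] (ex_intro _ _ (imageP _ Hw0)).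
split; first by exists w; rewrite -F2_lengthE.
move=> v Hv v1; rewrite -F2_lengthE; apply: lbm; exists v => //.
by split=> //; apply/eqP.
Qed.

Lemma alpha_ex n : exists w : F2, [/\ lower_central n w, w != 1 & size w = alpha n].
Proof. by have [] := min_lengthP (lower_central_neq0 n). Qed.

Lemma alpha_le n (w : F2) : lower_central n w -> w != 1 -> (alpha n <= size w)%N.
Proof. by have [_] := min_lengthP (lower_central_neq0 n); apply. Qed.

Lemma beta_ex n : exists w : F2, [/\ derived n w, w != 1 & size w = beta n].
Proof. by have [] := min_lengthP (derived_neq0 n). Qed.

Lemma beta_le n (w : F2) : derived n w -> w != 1 -> (beta n <= size w)%N.
Proof. by have [_] := min_lengthP (derived_neq0 n); apply. Qed.

Lemma size_gt0_neq1 (w : F2) : w != 1 -> (0 < size w)%N.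
Proof. by rewrite lt0n size_eq0 word_eq1. Qed.

Lemma alpha_gt0 n : (0 < alpha n)%N.
Proof. by have [w [_ w1 <-]] := alpha_ex n; apply: size_gt0_neq1. Qed.

Lemma beta_gt0 n : (0 < beta n)%N.
Proof. by have [w [_ w1 <-]] := beta_ex n; apply: size_gt0_neq1. Qed.

Lemma leq_alpha m n : (m <= n)%N -> (alpha m <= alpha n)%N.
Proof.
move=> mn; have [w [Cw w1 <-]] := alpha_ex n.
by apply: alpha_le => //; apply: lower_central_sub mn _ Cw.
Qed.

Lemma leq_beta m n : (m <= n)%N -> (beta m <= beta n)%N.
Proof.
move=> mn; have [w [Dw w1 <-]] := beta_ex n.
by apply: beta_le => //; apply: derived_sub mn _ Dw.
Qed.

Lemma alphaM m n : (0 < m)%N -> (0 < n)%N ->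
  (alpha (m * n) <= 3 * alpha m * alpha n)%N.
Proof.
move=> m0 n0; have [u [Cu u1 um]] := alpha_ex m; have [v [Cv v1 vn]] := alpha_ex n.
have sC := @subgroup_lower_central F2 m.
have [|h [hV Ch hs hv]] := @short_free_pair _ sC (@lower_central_conj _ m) u Cu u1.
  by move=> w Cw w1; rewrite um; apply: alpha_le.
apply: (@leq_trans (size (subst h v))).
  apply: alpha_le; last exact: hv.
  apply: (morph_lower_central (substM hV)) => // w; exact: subst_subgroup.
apply: leq_trans (size_subst v hs) _; rewrite vn mulnC leq_mul2r um.
(* The free pair has lengths at most [alpha m + 2 <= 3 * alpha m]. *)
by have := alpha_gt0 m; lia.
Qed.

Lemma betaD m n : (beta (m + n) <= 3 * beta m * beta n)%N.
Proof.
have [u [Du u1 um]] := beta_ex m; have [v [Dv v1 vn]] := beta_ex n.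
have sD := @subgroup_derived F2 m.
have [|h [hV Dh hs hv]] := @short_free_pair _ sD (@derived_conj _ m) u Du u1.
  by move=> w Dw w1; rewrite um; apply: beta_le.
apply: (@leq_trans (size (subst h v))).
  apply: beta_le; last exact: hv.
  apply: (morph_derived (substM hV)) => // w; exact: subst_subgroup.
apply: leq_trans (size_subst v hs) _; rewrite vn mulnC leq_mul2r um.
by have := beta_gt0 m; lia.
Qed.

Lemma alpha1 : alpha 1 = 1%N.
Proof.
apply/eqP; rewrite eqn_leq alpha_gt0 andbT.
exact: (@alpha_le 1 gen_a).
Qed.

Lemma beta0 : beta 0 = 1%N.
Proof.
apply/eqP; rewrite eqn_leq beta_gt0 andbT.
exact: (@beta_le 0 gen_a).
Qed.

End ShortestElements.

(** * Three girths *)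

Section Flow.
Variable N : set F2.
Hypotheses (sN : is_subgroup N) (nN : conj_closed N).
Local Open Scope group_scope.

Definition prefix_prod (s : seq letter) (k : nat) : F2 :=
  \prod_(l <- take k s) letter_F2 l.

Lemma prefix_prod0 s : prefix_prod s 0 = 1.
Proof. by rewrite /prefix_prod take0 big_nil. Qed.

Lemma prefix_prod_cons l s k :
  prefix_prod (l :: s) k.+1 = letter_F2 l * prefix_prod s k.
Proof. by rewrite /prefix_prod /= big_cons. Qed.

Lemma prefix_prodS l s k : (k < size s)%N ->
  prefix_prod s k.+1 = prefix_prod s k * letter_F2 (nth l s k).
Proof. by move=> ks; rewrite /prefix_prod (take_nth l) // -cats1 big_cat big_seq1. Qed.

(* The net number of times that the path labelled by [s], started at the coset
   of [g] in the Cayley graph of the quotient by [N], runs along the edge that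
   leaves the trivial coset with label [l]. *)
Fixpoint flow (l : letter) (g : F2) (s : seq letter) : int :=
  if s is m :: s' then
    (((`[< N g >] && (m == l))%:R
    - (`[< N (g * letter_F2 m)%g >] && (m == linv l))%:R)
    + flow l (g * letter_F2 m)%g s')%R
  else 0%R.

(** A letter followed by its inverse runs along one edge in both directions, with net contribution
    zero. *)
Lemma flow_push l g m s : flow l g (push m s) = flow l g (m :: s).
Proof.
case: s => [|k s] //=; case: eqVneq => [->|//].
rewrite letter_F2V mulgK (inj_eq (inv_inj linvK)) -(inv_eq linvK m l).
ring.
Qed.

Lemma flow_wmul l g u v : flow l g (wmul u v) =
  (flow l g u + flow l (g * \prod_(m <- u) letter_F2 m)%g v)%R.
Proof.
elim: u g => [|m u IH] g /=; first by rewrite big_nil mulg1 add0r.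
by rewrite flow_push /= IH big_cons mulgA addrA.
Qed.

Lemma flowM l g (u v : F2) :
  flow l g (u * v) = (flow l g u + flow l (g * u)%g v)%R.
Proof. by rewrite {3}[u]F2_prod_letters -flow_wmul. Qed.

Lemma mulN g h : N g -> `[< N (g * h) >] = `[< N h >].
Proof.
have [_ NM NV] := sN; move=> Ng; apply/asboolP/asboolP; last exact: NM.
by move=> /(NM _ _ (NV _ Ng)); rewrite mulgA mulVg mul1g.
Qed.

Lemma flow_left l g h s : N g -> flow l (g * h) s = flow l h s.
Proof.
by move=> Ng; elim: s h => //= m s IH h; rewrite -!mulgA !(mulN _ Ng) IH.
Qed.

Lemma flow_right l g u s : N u -> flow l (g * u) s = flow l g s.
Proof.
by move=> Nu; rewrite -[in LHS](mulgVK g (g * u)) flow_left //; apply: nN.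
Qed.

Lemma flowV l g (u : F2) : N u -> flow l g u^-1 = (- flow l g u)%R.
Proof.
move=> Nu; apply/eqP; rewrite -addr_eq0 addrC -(@flow_right l g u (word u^-1) Nu) -flowM.
by rewrite mulgV.
Qed.

(** By [flow_right], the flow from a fixed start restricts to a homomorphism from [N] to the
    integers, which kills commutators. *)
Lemma flow_comm_subgroup l g (w : F2) : comm_subgroup N N w -> flow l g w = 0%R.
Proof.
have [_ _ NV] := sN; move=> Cw.
suff : comm_subgroup N N `<=` [set u : F2 | forall g, flow l g u = 0%R] by move=> /(_ _ Cw).
apply: comm_subgroup_sub => {g w Cw} [|x y Nx Ny g].
  split=> [g //|u v fu fv g|u fu g] /=; first by rewrite flowM fu fv.
  have : flow l g (u^-1 * u) = 0%R by rewrite mulVg.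
  by rewrite flowM fu addr0.
have [NVx NVy] := (NV _ Nx, NV _ Ny).
rewrite /comm !flowM !(flow_right _ _ _ Nx, flow_right _ _ _ Ny, flow_right _ _ _ NVx, mulgA).
by rewrite (flowV _ _ Nx) (flowV _ _ Ny); ring.
Qed.

(** An edge used forwards and never backwards would have positive net flow. *)
Lemma flow_return l g s i : (i < size s)%N -> nth l s i = l ->
  N (g * prefix_prod s i) -> flow l g s = 0%R ->
  exists j, [/\ (j < size s)%N, nth l s j = linv l & N (g * prefix_prod s j.+1)].
Proof.
move=> is_ Ei Ni f0; apply: contrapT => no.
suff : (0 <= flow l g s)%R /\ (forall i, (i < size s)%N -> nth l s i = l ->
    N (g * prefix_prod s i) -> (0 < flow l g s)%R).
  by move=> [_ /(_ i is_ Ei Ni)]; rewrite f0.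
elim: s g no {i is_ Ei Ni f0} => // m s IH g no.
have [|IH0 IH1] := IH (g * letter_F2 m).
  move=> [j [js Ej Nj]]; apply: no; exists j.+1; split=> //.
  by rewrite prefix_prod_cons mulgA.
rewrite /=; have -> : `[< N (g * letter_F2 m) >] && (m == linv l) = false.
  apply/negP => /andP[/asboolP Nm /eqP E]; apply: no; exists 0%N; split=> //.
  by rewrite prefix_prod_cons prefix_prod0 mulg1.
rewrite subr0; split=> [|[|i] is_ Ei Ni].
- by rewrite addr_ge0.
- have -> : `[< N g >] && (m == l).
    by rewrite -Ei eqxx andbT; apply/asboolP; move: Ni; rewrite prefix_prod0 mulg1.
  by rewrite ltr_wpDr.
- by rewrite ltr_wpDl// (IH1 i)// -mulgA -prefix_prod_cons.
Qed.

Variable m : nat.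
Hypothesis leN : forall v : F2, N v -> v != 1 -> (m <= size v)%N.
Variable w : F2.
Hypotheses (Nw : comm_subgroup N N w) (w1 : w != 1).
Hypothesis minw :
  forall v : F2, comm_subgroup N N v -> v != 1 -> (size w <= size v)%N.

Let P := prefix_prod (word w).
(** The path labelled by [w] stands at the same vertex of the quotient graph at times [i] and
    [j]. *)
Let visit i j := N ((P i)^-1 * P j).

Let P_size : P (size w) = w.
Proof. by rewrite /P /prefix_prod take_size -F2_prod_letters. Qed.

Let Nw' : N w.
Proof.
have [_ NM NV] := sN.
suff : comm_subgroup N N `<=` N by apply.
apply: comm_subgroup_sub => // x y Nx Ny.
by apply: (NM); [apply: (NM); [apply: (NM)|]|]; rewrite //; apply: (NV).
Qed.

Let visit_sym i j : visit i j -> visit j i.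
Proof. by have [_ _ NV] := sN; move=> /NV; rewrite invgM invgK. Qed.

Let visit_trans i j k : visit i j -> visit j k -> visit i k.
Proof.
by have [_ NM _] := sN; move=> /NM /[apply]; rewrite mulgA mulgK.
Qed.

Let size_segment i j : (i <= j <= size w)%N -> size ((P i)^-1 * P j)%g = (j - i)%N.
Proof.
move=> /andP[ij jw]; pose s := drop i (take j (word w)).
have rs : reduced s.
  apply: drop_sorted; apply: take_sorted; exact: word_reduced.
suff -> : (P i)^-1 * P j = MkF2 rs by rewrite /= /s size_drop size_takel.
apply: (mulgI (P i)); rewrite mulgA mulgV mul1g /P /prefix_prod.
rewrite -[take j _](cat_take_drop i) big_cat /= take_takel //; congr (_ * _).
by rewrite -/s [RHS]F2_prod_letters.
Qed.

Let visit_gap i j : (i < j <= size w)%N -> visit i j -> (m <= j - i)%N.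
Proof.
move=> /andP[ij jw] Vij; rewrite -(@size_segment i j) ?jw ?(ltnW ij) //.
apply: leN => //; rewrite -word_eq1 -size_eq0 size_segment ?jw ?(ltnW ij) //.
by rewrite -lt0n subn_gt0.
Qed.

(** [z] labels the closed path from time [j] round to time [i]. Were it trivial, a conjugate of [w]
    would equal the segment from [i] to [j], which is shorter than [w]. *)
Let visit_cogap i j : (i < j < size w)%N -> visit i j -> (m <= size w - (j - i))%N.
Proof.
move=> /andP[ij jw] Vij; have [_ NM NV] := sN.
pose z : F2 := (P j)^-1 * w * P i.
have jw' := ltnW jw; have ij' := ltnW ij.
have zE : z = ((P j)^-1 * P (size w)) * ((P 0)^-1 * P i).
  by rewrite P_size /z /P prefix_prod0 invg1 mul1g.
apply: (@leq_trans (size z)); last first.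
  rewrite zE; apply: leq_trans (size_wmul _ _) _.
  by rewrite !size_segment ?jw' ?leqnn //; lia.
apply: leN.
  have -> : z = ((P i)^-1 * P j)^-1 * ((P i)^-1 * w * (P i)^-1^-1).
    by rewrite /z invgM !invgK !mulgA mulgK.
  by apply: NM; [apply: NV|apply: nN].
apply/eqP => z1; pose v : F2 := (P i)^-1 * w * (P i)^-1^-1.
have vE : v = (P i)^-1 * P j.
  have wE : w = P j * 1 * (P i)^-1 by rewrite -z1 /z !mulgA mulgK mulgV mul1g.
  by rewrite /v invgK wE mulg1 !mulgA mulgVK.
have v1 : v != 1.
  by rewrite vE -word_eq1 -size_eq0 size_segment ?jw' ?ij' //; lia.
have := minw (comm_subgroup_conj nN nN (P i)^-1 Nw) v1.
by rewrite -/v vE size_segment ?jw' ?ij' //; lia.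
Qed.

(** The visits cut the closed path into three arcs, each of length at least [m]. *)
Let three_visits i j k : (i < j < k)%N -> (k < size w)%N ->
  visit i j -> visit j k -> (3 * m <= size w)%N.
Proof.
move=> /andP[ij jk] kw Vij Vjk.
have := @visit_gap i j; have := @visit_gap j k; have := @visit_cogap i k.
rewrite ij jk kw (ltn_trans ij jk) !(ltnW kw) (ltnW (ltn_trans jk kw)).
move=> /(_ isT (visit_trans Vij Vjk)) + /(_ isT Vjk) + /(_ isT Vij); lia.
Qed.

(** The edge taken at time [i] has zero net flow, so the path also runs along it backwards, at an
    earlier or later time [k]. *)
Let return_edge i : (i < size w)%N -> exists k, [/\ (k < size w)%N,
  nth (false, false) w k = linv (nth (false, false) w i) & visit i k.+1].
Proof.
move=> iw; set l := nth _ w i.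
have [] := @flow_return l (P i)^-1 w i iw.
- by rewrite (set_nth_default (false, false)).
- by rewrite mulVg; have [] := sN.
- exact: flow_comm_subgroup.
move=> k [kw Ek Vk]; exists k; split=> //.
by rewrite (set_nth_default l).
Qed.

Let no_backtrack i : (i.+1 < size w)%N ->
  nth (false, false) w i.+1 != linv (nth (false, false) w i).
Proof.
move=> iw; have /(sortedP (false, false)) := word_reduced w.
exact.
Qed.

(* If no vertex of the closed path [w] is visited three times, then a pair of
   visits between which the path leaves along an edge and comes back along the
   same edge shrinks to a shorter such pair. *)
Let shrink n i j : (j - i <= n)%N -> (i < j < size w)%N ->
  nth (false, false) w j = linv (nth (false, false) w i) -> visit i j.+1 ->
  (3 * m <= size w)%N.
Proof.
elim: n i j => [|n IH] i j ijn /andP[ij jw] Eij Vij; first lia.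
have ij1 : (i.+1 < j)%N.
  rewrite ltn_neqAle ij andbT; apply/eqP => Ej.
  by have := no_backtrack (i := i); rewrite Ej jw Eij eqxx => /(_ isT).
have Vij' : visit i.+1 j.
  have := nN (letter_F2 (nth (false, false) w i))^-1 Vij.
  rewrite /visit /P (prefix_prodS (false, false)) // Eij letter_F2V.
  rewrite (@prefix_prodS (false, false) _ i) ?(ltn_trans ij) //.
  by rewrite invgM !mulgA mulgK.
(* The vertex at times [i+1] and [j] is also reached at time [k+1]. Either [k+1 = j] and the pair
   [(i+1, k)] is shorter, or there are three visits, where [k+1 = size w] is read as time 0. *)
have [k [kw Ek Vk]] := return_edge (ltn_trans ij1 jw).
have ki : k != i.
  apply/eqP => Eki; have := no_backtrack (ltn_trans ij1 jw).
  by rewrite -[X in X != _]linvK -Ek Eki eqxx.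
have [kj|kj] := eqVneq k.+1 j.
  have ik : (i.+1 < k)%N.
    rewrite ltn_neqAle -ltnS kj ij1 andbT; apply/eqP => Eik.
    by move: Ek; rewrite -Eik => /eqP; rewrite eq_sym (negbTE (linv_neq _)).
  apply: (IH i.+1 k) => //; [lia|by rewrite ik kw].
have [kw'|] := ltnP k.+1 (size w).
  have Vkj := visit_trans (visit_sym Vk) Vij'.
  have [ki'|ki'] := ltnP k i.
    by apply: (@three_visits k.+1 i.+1 j) => //; [lia|exact: visit_sym].
  have [kj'|kj'] := ltnP k.+1 j.
    by apply: (@three_visits i.+1 k.+1 j) => //; lia.
  apply: (@three_visits i.+1 j k.+1) => //; [lia|exact: visit_sym].
move=> kw'; have {}kw' : k.+1 = size w by lia.
apply: (@three_visits 0 i.+1 j) => //; apply: visit_sym.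
have [_ NM NV] := sN; move: Vk; rewrite /visit kw' P_size /P prefix_prod0 mulg1.
move=> Vk; have := NM _ _ Vk (NV _ Nw'); by rewrite mulgK.
Qed.

Lemma three_girths : (3 * m <= size w)%N.
Proof.
have w0 := size_gt0_neq1 w1.
have [k [kw Ek Vk]] := return_edge w0.
apply: (@shrink k 0 k) => //; first lia.
rewrite kw andbT lt0n; apply/eqP => k0.
by move: Ek; rewrite k0 => /eqP; rewrite eq_sym (negbTE (linv_neq _)).
Qed.

End Flow.

Lemma beta_triple n : (3 * beta n <= beta n.+1)%N.
Proof.
have [w [Dw w1 wE]] := beta_ex n.+1; rewrite -wE.
apply: (three_girths (@subgroup_derived _ n) (@derived_conj _ n) _ Dw w1).
  by move=> v; apply: beta_le.
by move=> v Dv v1; rewrite wE; apply: beta_le.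
Qed.

Lemma beta_lb n : (3 ^ n <= beta n)%N.
Proof.
elim: n => [|n IH]; first exact: beta_gt0.
by rewrite expnS; apply: leq_trans (beta_triple n); rewrite leq_mul2l.
Qed.

(** * Numerical bounds *)

Lemma expn_N (a b : N) : (N.to_nat a ^ N.to_nat b)%N = N.to_nat (N.pow a b).
Proof.
rewrite N2Nat.inj_pow; elim: (N.to_nat b) => //= k IH.
by rewrite expnS IH.
Qed.

(* Reduces to binary arithmetic, where the inequality can be computed. *)
Lemma leq_expn_N (m n k l m' n' k' l' : nat) :
  let pow x y := N.pow (N.of_nat x) (N.of_nat y) in
  N.leb (N.mul (pow m m') (pow n n')) (N.mul (pow k k') (pow l l')) ->
  (m ^ m' * n ^ n' <= k ^ k' * l ^ l')%N.
Proof.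
have E x y : (x ^ y)%N = N.to_nat (N.pow (N.of_nat x) (N.of_nat y)).
  by rewrite -expn_N !Nat2N.id.
move=> pow; rewrite !E -!/(pow _ _).
by move: (pow m m') (pow n n') (pow k k') (pow l l') => *; lia.
Qed.

Section Log2.
Variable R : realType.
Implicit Types x y : R.

Lemma ln2_gt0 : 0 < ln 2 :> R.
Proof. by apply: ln_gt0; rewrite ltr1n. Qed.

Lemma log2M x y : 0 < x -> 0 < y -> log2 (x * y) = log2 x + log2 y.
Proof. by move=> x0 y0; rewrite /log2 lnM ?posrE // mulrDl. Qed.

Lemma log2V x : 0 < x -> log2 x^-1 = - log2 x.
Proof. by move=> x0; rewrite /log2 lnV ?posrE // mulNr. Qed.

Lemma log2X x n : 0 < x -> log2 (x ^+ n) = log2 x * n%:R.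
Proof. by move=> x0; rewrite /log2 lnXn // -[_ *+ n]mulr_natr mulrAC. Qed.

Lemma log2_2 : log2 2 = 1 :> R.
Proof. by rewrite /log2 divff // gt_eqF // ln2_gt0. Qed.

Lemma ler_log2 x y : 0 < x -> x <= y -> log2 x <= log2 y.
Proof.
move=> x0 xy; rewrite /log2 ler_pM2r ?invr_gt0 ?ln2_gt0 //.
by rewrite ler_ln ?posrE // (lt_le_trans x0).
Qed.

Lemma log2_gt0 x : 1 < x -> 0 < log2 x.
Proof. by move=> x1; rewrite divr_gt0 ?ln2_gt0 ?ln_gt0. Qed.

Lemma log2_ge0 x : 1 <= x -> 0 <= log2 x.
Proof. by move=> x1; rewrite divr_ge0 ?ln_ge0 ?ler1n. Qed.

Lemma ratio_pow_le (m n k l p q : nat) : (0 < n)%N -> (0 < l)%N ->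
  (m ^ p * l ^ q <= k ^ q * n ^ p)%N ->
  (m%:R / n%:R) ^+ p <= (k%:R / l%:R) ^+ q :> R.
Proof.
move=> n0 l0 h; rewrite !expr_div_n ler_pdivrMr ?exprn_gt0 ?ltr0n //.
rewrite mulrAC ler_pdivlMr ?exprn_gt0 ?ltr0n //.
by rewrite -!natrX -!natrM ler_nat.
Qed.

Lemma log2_ratio_le (m n k l p q : nat) : (0 < m)%N -> (0 < n)%N ->
  (0 < k)%N -> (0 < l)%N -> (m ^ p * l ^ q <= k ^ q * n ^ p)%N ->
  log2 (m%:R / n%:R) * p%:R <= log2 (k%:R / l%:R) * q%:R :> R.
Proof.
move=> m0 n0 k0 l0 h; rewrite -!log2X ?divr_gt0 ?ltr0n //.
by apply: ler_log2; [rewrite exprn_gt0 // divr_gt0 ?ltr0n|apply: ratio_pow_le].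
Qed.

Let x : R := growth R.
Let y : R := 1 + Num.sqrt 2.

Lemma growth_gt1 : 1 < growth R.
Proof. by have := growth_lb R; lra. Qed.

Lemma log2_growth : log2 (3 + Num.sqrt 17) - 1 = log2 (growth R).
Proof.
by rewrite /growth log2M ?invr_gt0 ?log2V ?log2_2 // ltr_wpDr // sqrtr_ge0.
Qed.

(** Here [239/169], and below [577/408], are consecutive convergents to the square root of 2. *)
Lemma silver_lb : 408 / 169 <= y.
Proof.
have : 239 / 169 <= Num.sqrt (2 : R) by apply: sqrt_lb; lra.
rewrite /y; lra.
Qed.

Lemma silver_ub : y <= 985 / 408.
Proof.
have : Num.sqrt (2 : R) <= 577 / 408 by apply: sqrt_ub; lra.
rewrite /y; lra.
Qed.

Lemma silver_root : y ^+ 2 = 2 * y + 1.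
Proof.
have : (Num.sqrt 2 : R) ^+ 2 = 2 by rewrite sqr_sqrtr.
by rewrite /y => h; ring: h.
Qed.

(** Both fractions lie in the decimal window to be certified. Clearing denominators leaves integer
    comparisons such as [2^733 * 130^400 <= 463^400]. *)
Lemma log2_growth_bounds : 733 / 400 <= log2 x <= 372 / 203.
Proof.
have h1 : log2 (463%:R / 130%:R) <= log2 x.
  by apply: ler_log2; [lra|exact: growth_lb].
have h2 : log2 x <= log2 (3761%:R / 1056%:R).
  by apply: ler_log2; [have := growth_gt1; rewrite /x; lra|exact: growth_ub].
have h3 : log2 (2%:R / 1%:R) * 733%:R <= log2 (463%:R / 130%:R) * 400%:R :> R.
  by apply: log2_ratio_le; [..|apply: leq_expn_N; vm_compute].
have h4 : log2 (3761%:R / 1056%:R) * 203%:R <= log2 (2%:R / 1%:R) * 372%:R :> R.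
  by apply: log2_ratio_le; [..|apply: leq_expn_N; vm_compute].
rewrite divr1 log2_2 in h3 h4; apply/andP; split; lra.
Qed.

Lemma log2_silver_gt0 : 0 < log2 y.
Proof. by apply: log2_gt0; have := silver_lb; lra. Qed.

Lemma exponent_bounds : 575 / 399 <= log2 x / log2 y <= 49 / 34.
Proof.
have y0 := log2_silver_gt0.
have h1 : log2 (463%:R / 130%:R) <= log2 x.
  by apply: ler_log2; [lra|exact: growth_lb].
have h2 : log2 x <= log2 (3761%:R / 1056%:R).
  by apply: ler_log2; [have := growth_gt1; rewrite /x; lra|exact: growth_ub].
have h3 : log2 (408%:R / 169%:R) <= log2 y.
  by apply: ler_log2; [lra|exact: silver_lb].
have h4 : log2 y <= log2 (985%:R / 408%:R).
  by apply: ler_log2; [have := silver_lb; lra|exact: silver_ub].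
have h5 : log2 (985%:R / 408%:R) * 575%:R <= log2 (463%:R / 130%:R) * 399%:R :> R.
  by apply: log2_ratio_le; [..|apply: leq_expn_N; vm_compute].
have h6 : log2 (3761%:R / 1056%:R) * 34%:R <= log2 (408%:R / 169%:R) * 49%:R :> R.
  by apply: log2_ratio_le; [..|apply: leq_expn_N; vm_compute].
by rewrite ler_pdivlMr // ler_pdivrMr //; apply/andP; split; lra.
Qed.

(** Powers of [y] satisfy the Pell recursion by [silver_root], so two base cases suffice. *)
Lemma pell_lb n : y ^+ n <= 2 * (pell n)%:R.
Proof.
elim/ltn_ind: n => [[|[|n]]] IH.
- by rewrite expr0 -[pell 0]/1%N; lra.
- by rewrite expr1 -[pell 1]/2%N (le_trans silver_ub) //; lra.
rewrite -[pell _]/(2 * pell n.+1 + pell n)%N natrD natrM.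
have := IH n (ltnW (ltnSn _)); have := IH n.+1 (ltnSn _).
rewrite -[n.+2]addn2 exprD silver_root exprSr; lra.
Qed.

End Log2.

(** * Limits *)

Section Limits.
Variables (R : realType) (F T : nat -> R).
Hypothesis T_gt0 : forall n, (1 < n)%N -> 0 < T n.
Hypothesis Ty : T n @[n --> \oo] --> +oo.

Lemma near_small (K e : R) : 0 < e -> \forall n \near \oo, K < e * T n.
Proof.
move=> e0; have /cvgryPgt/(_ (K / e)) := Ty.
by apply: filterS => n; rewrite ltr_pdivrMr // mulrC.
Qed.

Lemma nbhs_gt1 : \forall n \near \oo, (1 < n)%N.
Proof. by exists 2%N. Qed.

Section Fekete.
Variable c : R.
(** In the applications [F] is the logarithm of a minimal length. Index [n] is reached by at most
    [T n / T m + 1] factors of index [m], each costing [F m + c] with [c = log2 3]. *)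
Hypothesis F_le : forall m n, (1 < m)%N -> (1 < n)%N ->
  F n <= (T n / T m + 1) * (F m + c).
Hypotheses (F_ge0 : forall n, 0 <= F n) (c_ge0 : 0 <= c).

(* The limit is the infimum of [(F m + c) / T m]. *)
Lemma fekete_cvg : cvgn (fun n => F n / T n).
Proof.
pose G m := (F m + c) / T m.
pose A := [set G m | m in [set m | 1 < m]%N].
have G_ge0 m : (1 < m)%N -> 0 <= G m.
  by move=> m1; rewrite divr_ge0 ?addr_ge0 // ltW ?T_gt0.
have infA : has_inf A.
  split; first by exists (G 2%N), 2%N.
  by exists 0 => _ [m m1 <-]; apply: G_ge0.
apply/cvg_ex; exists (inf A); apply/cvgrPdist_le => e e0.
have e20 : 0 < e / 2 by rewrite divr_gt0.
have [_ [m /= m1 <-] Gm] := inf_adherent e20 infA.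
have := @near_small c _ e0; have := @near_small (F m + c) _ e20.
apply: filterS3 nbhs_gt1 => n n1 h1 h2; have Tn := T_gt0 n1; have Tm := T_gt0 m1.
have lb : inf A <= G n by apply: ge_inf; [case: infA|exists n].
rewrite ler_distlC; apply/andP; split.
  rewrite lerBlDr (le_trans lb) // /G mulrDl lerD2l ler_pdivrMr // ltW //.
(* With [m] fixed so that [G m] is close to the infimum, the constant [F m + c] is eventually below
   [e / 2 * T n]. *)
have ub : F n <= T n * G m + (F m + c).
  apply: le_trans (F_le m1 n1) _.
  by rewrite /G mulrDl mul1r (mulrC (F m + c)) mulrA.
have {}Gm : T n * G m <= T n * (inf A + e / 2) by rewrite ler_pM2l // ltW.
rewrite ler_pdivrMr //; move: Gm; rewrite mulrDr mulrDl !(mulrC (T n)); lra.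
Qed.

End Fekete.

Lemma limit_le (b K : R) : cvgn (fun n => F n / T n) ->
  (forall n, (1 < n)%N -> F n <= b * T n + K) -> limn (fun n => F n / T n) <= b.
Proof.
move=> cF le_F; apply/ler_addgt0Pr => e e0; apply: limr_le => //.
apply: filterS2 nbhs_gt1 (near_small K e0) => n n1 Kn.
rewrite ler_pdivrMr ?T_gt0 // mulrDl (le_trans (le_F n n1)) // lerD2l ltW //.
Qed.

End Limits.

Section Asymptotics.
Variable R : realType.
Let x : R := growth R.
Let y : R := 1 + Num.sqrt 2.

Lemma log2_dvgn : (log2 n%:R : R) @[n --> \oo] --> +oo.
Proof.
apply/cvgryPge => A; near=> n.
have -> : A = A * ln 2 / ln 2 :> R by rewrite mulfK // gt_eqF // ln2_gt0.
rewrite /log2 ler_pM2r ?invr_gt0 ?ln2_gt0 // -[leLHS]expRK ler_ln ?posrE ?expR_gt0 //.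
  near: n; exact: nbhs_infty_ger.
by rewrite ltr0n; near: n; exact: nbhs_infty_gt.
Unshelve. all: by end_near.
Qed.

Lemma log2_alpha_ge0 n : 0 <= log2 (alpha n)%:R :> R.
Proof. by rewrite log2_ge0 // ler1n alpha_gt0. Qed.

Lemma log2_beta_ge0 n : 0 <= log2 (beta n)%:R :> R.
Proof. by rewrite log2_ge0 // ler1n beta_gt0. Qed.

Lemma alpha_expn m k : (0 < m)%N -> (alpha (m ^ k) <= (3 * alpha m) ^ k)%N.
Proof.
move=> m0; elim: k => [|k IH]; first by rewrite !expn0 alpha1.
rewrite !expnS; apply: leq_trans (alphaM _ _) _; rewrite ?expn_gt0 ?m0 //.
by rewrite leq_mul2l IH orbT.
Qed.

Lemma beta_muln m k : (beta (k * m) <= (3 * beta m) ^ k)%N.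
Proof.
elim: k => [|k IH]; first by rewrite mul0n beta0.
rewrite mulSn expnS; apply: leq_trans (betaD _ _) _.
by rewrite leq_mul2l IH orbT.
Qed.

Lemma log2_expn_le (u v k : nat) : (0 < u)%N -> (0 < v)%N -> (u <= (3 * v) ^ k)%N ->
  log2 u%:R <= k%:R * (log2 v%:R + log2 3) :> R.
Proof.
move=> u0 v0 uv; rewrite addrC -log2M ?ltr0n // mulrC -log2X ?mulr_gt0 ?ltr0n //.
by apply: ler_log2; rewrite ?ltr0n // -natrM -natrX ler_nat.
Qed.

Lemma log2_nat_gt0 n : (1 < n)%N -> 0 < log2 n%:R :> R.
Proof. by move=> n1; rewrite log2_gt0 // ltr1n. Qed.

Lemma log2_3_ge0 : 0 <= log2 3 :> R.
Proof. by apply: log2_ge0; lra. Qed.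

Lemma alpha_cvg : cvgn (@alpha_ratio R).
Proof.
apply: (fekete_cvg log2_nat_gt0 log2_dvgn) log2_alpha_ge0 log2_3_ge0 => m n m1 n1.
(* Here [m^k <= n < m^(k+1)], so [k] is at most [log2 n / log2 m]. *)
have m0 := ltnW m1; have n0 := ltnW n1; set k := trunc_log m n.
have /andP[mk nk] := trunc_log_bounds m1 n0.
have an : (alpha n <= (3 * alpha m) ^ k.+1)%N.
  exact: leq_trans (leq_alpha (ltnW nk)) (alpha_expn _ m0).
apply: le_trans (log2_expn_le (alpha_gt0 n) (alpha_gt0 m) an) _.
apply: ler_wpM2r; first by rewrite addr_ge0 ?log2_alpha_ge0 ?log2_3_ge0.
rewrite -natr1 lerD2r ler_pdivlMr ?log2_nat_gt0 // mulrC -log2X ?ltr0n //.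
by apply: ler_log2; rewrite -natrX ?ltr0n ?expn_gt0 ?m0 // ler_nat.
Qed.

Lemma beta_cvg : cvgn (@beta_ratio R).
Proof.
have T0 n : (1 < n)%N -> 0 < n%:R :> R by move=> n1; rewrite ltr0n ltnW.
apply: (fekete_cvg T0 cvgr_idn) log2_beta_ge0 log2_3_ge0 => m n m1 n1.
have m0 := ltnW m1; set k := (n %/ m)%N.
have bn : (beta n <= (3 * beta m) ^ k.+1)%N.
  by apply: leq_trans (beta_muln _ _); rewrite leq_beta // ltnW // ltn_ceil.
apply: le_trans (log2_expn_le (beta_gt0 n) (beta_gt0 m) bn) _.
apply: ler_wpM2r; first by rewrite addr_ge0 ?log2_beta_ge0 ?log2_3_ge0.
rewrite -natr1 lerD2r ler_pdivlMr ?ltr0n // -natrM ler_nat.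
exact: leq_divM.
Qed.

Lemma log2_size_iter_phi n :
  log2 (size (iter n phi gen_a))%:R <= 1 + log2 x * n%:R.
Proof.
have x0 : 0 < x by rewrite (lt_trans ltr01) ?growth_gt1.
have -> : 1 + log2 x * n%:R = log2 (2 * x ^+ n).
  by rewrite log2M ?exprn_gt0 // log2_2 log2X.
apply: ler_log2; last exact: size_iter_phi_le.
rewrite ltr0n size_gt0_neq1 //; exact/iter_phi_neq1/gen_a_neq1.
Qed.

Lemma log2_beta_le n : log2 (beta n)%:R <= log2 x * n%:R + 1.
Proof.
rewrite addrC; apply: le_trans (log2_size_iter_phi n).
apply: ler_log2; rewrite ?ltr0n ?beta_gt0 // ler_nat.
apply: beta_le; [exact: iter_phi_derived|exact/iter_phi_neq1/gen_a_neq1].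
Qed.

(** Collects the factor 2 of [size_iter_phi_le] and the factor [2 * y] lost in choosing the Pell
    index. *)
Let K : R := 1 + log2 x / log2 y * (1 + log2 y).

Lemma log2_alpha_le n : (0 < n)%N ->
  log2 (alpha n)%:R <= log2 x / log2 y * log2 n%:R + K.
Proof.
move=> n0; have ly := log2_silver_gt0 R.
have x0 : 0 < log2 x by rewrite log2_gt0 ?growth_gt1.
have y0 : 0 < y by have := silver_lb R; rewrite -/y; lra.
(* Take the least [k]: when it is positive, [pell (k-1) < n], and [pell_lb] gives
   [y^(k-1) <= 2n]. *)
have [k nk yk] : exists2 k, (n <= pell k)%N & y ^+ k <= 2 * y * n%:R.
  have ex : exists k, (n <= pell k)%N by exists n; rewrite ltnW ?ltn_pell.
  case: (ex_minnP ex) => -[|k] nk mink; [exists 0%N|exists k.+1] => //.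
    have n1 : 1 <= n%:R :> R by rewrite ler1n.
    by have := silver_lb R; rewrite expr0 -/y; nra.
  rewrite exprSr (mulrAC 2 y) ler_pM2r //.
  apply: le_trans (pell_lb R k) _; rewrite ler_pM2l // ler_nat ltnW //.
  by rewrite ltnNge; apply/negP => /mink; rewrite ltnn.
have ak : log2 (alpha n)%:R <= 1 + log2 x * k%:R.
  apply: le_trans (log2_size_iter_phi k).
  apply: ler_log2; rewrite ?ltr0n ?alpha_gt0 // ler_nat.
  apply: alpha_le; last exact/iter_phi_neq1/gen_a_neq1.
  exact: lower_central_sub nk _ (iter_phi_lower_central_a k).
apply: le_trans ak _; rewrite /K addrCA lerD2l -mulrDr.
rewrite -mulrA ler_pM2l // ler_pdivlMl //.
have yk' : log2 (y ^+ k) <= log2 (2 * y * n%:R).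
  by apply: ler_log2 => //; rewrite exprn_gt0.
move: yk'; rewrite log2X // !log2M ?mulr_gt0 ?ltr0n // log2_2; lra.
Qed.

End Asymptotics.

Lemma alpha_preceq (R : realType) (eps : R) : 0 < eps ->
  let a := log2 (growth R) / log2 (1 + Num.sqrt 2) in
  preceq (fun n => (alpha n)%:R) (fun n => n%:R `^ (a + eps)).
Proof.
move=> eps0 a; set K : R := 1 + a * (1 + log2 (1 + Num.sqrt 2)).
have a0 : 0 <= a by have := exponent_bounds R; rewrite -/a; lra.
(* [C] is a positive integer bounding [2^K], the multiplicative form of the additive constant in
   [log2_alpha_le]. *)
pose C := (Num.truncn (expR (K * ln 2))).+1.
have CK : expR (K * ln 2) <= C%:R by rewrite ltW // truncnS_gt.
exists C => // n n0; have n0' : 0 < n%:R :> R by rewrite ltr0n.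
have n1 : 1 <= n%:R :> R by rewrite ler1n.
have ae : 0 <= a + eps by rewrite addr_ge0 // ltW.
apply: (@le_trans _ _ (C%:R * n%:R `^ (a + eps))); last first.
  apply: ler_wpM2l => //; apply: ge0_ler_powR; rewrite ?nnegrE //.
  by rewrite ler_nat leq_pmull.
apply: (@le_trans _ _ (expR (K * ln 2) * n%:R `^ a)); last first.
  by apply: ler_pM => //; rewrite ?expR_ge0 ?powR_ge0 // ler_powR // lerDl ltW.
rewrite /powR gt_eqF // -expRD -[leLHS]lnK ?posrE ?ltr0n ?alpha_gt0 // ler_expR.
have := log2_alpha_le R n0; rewrite -/a -/K {1 2}/log2 ler_pdivrMr ?ln2_gt0 //.
by rewrite mulrDl -mulrA divfK ?gt_eqF ?ln2_gt0 // addrC.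
Qed.

Theorem theorem2p2 (R : realType) :
  let a : R := (log2 (3 + Num.sqrt 17) - 1) / log2 (1 + Num.sqrt 2) in
  let b : R := log2 (3 + Num.sqrt 17) - 1 in
  [/\ cvgn (@alpha_ratio R),
      alpha_limit R <= a,
      14411 / 10000 <= a < 14412 / 10000 &
      forall eps : R, 0 < eps ->
        preceq (fun n => (alpha n)%:R) (fun n => n%:R `^ (a + eps))]
  /\
  [/\ cvgn (@beta_ratio R),
      log2 3 <= beta_limit R <= b,
      18325 / 10000 <= b < 18326 / 10000,
      forall n : nat, log2 3 * n%:R <= log2 (beta n)%:R :> R &
      exists2 h : nat -> R, is_o_n h &
        forall n : nat, log2 (beta n)%:R <= b * n%:R + h n].
Proof.
move=> a b; have bE : b = log2 (growth R) by exact: log2_growth.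
have aE : a = log2 (growth R) / log2 (1 + Num.sqrt 2) by rewrite /a -/b bE.
have beta_ge n : log2 3 * n%:R <= log2 (beta n)%:R :> R.
  rewrite -log2X //; apply: ler_log2; rewrite ?exprn_gt0 //.
  by rewrite -natrX ler_nat beta_lb.
split; split.
- exact: alpha_cvg.
- rewrite aE; apply: (limit_le (@log2_nat_gt0 R) (@log2_dvgn R) (@alpha_cvg R)).
  by move=> n n1; apply: log2_alpha_le; apply: ltnW.
- by rewrite aE; have := exponent_bounds R; lra.
- by move=> eps eps0; rewrite aE; apply: alpha_preceq.
- exact: beta_cvg.
- apply/andP; split.
    apply: limr_ge; first exact: beta_cvg.
    apply: filterS nbhs_gt1 => n n1.
    by rewrite ler_pdivlMr ?ltr0n ?(ltnW n1).
  rewrite bE; apply: (limit_le _ (@cvgr_idn R) (@beta_cvg R)) => [n n1|n _].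
    by rewrite ltr0n ltnW.
  exact: log2_beta_le.
- by rewrite bE; have := log2_growth_bounds R; lra.
- exact: beta_ge.
(* The error in [log2_beta_le] is the constant 1, which is [o(n)]. *)
- exists (fun=> 1); last by move=> n; rewrite bE; apply: log2_beta_le.
  apply/cvgrPdist_le => e e0; have := near_small (@cvgr_idn R) 1 e0.
  apply: filterS2 nbhs_gt1 => n n1 h; have n0 : 0 < n%:R :> R by rewrite ltr0n ltnW.
  by rewrite sub0r normrN ger0_norm ?divr_ge0 // ler_pdivrMr // ltW.
Qed.
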